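(* Let $R$ be a discrete valuation ring with uniformizer $t$. Let $\mathcal{P}$ be any additive Krull-Schmidt $R$-category where the endomorphism rings of indecomposable objects are commutative local $R$-algebras. Let $\mathcal{F}$ be the category of all pairs $(V,d)$ where $V$ is an object of $\mathcal{P}$ and $d$ is an endomorphism of $V$ with $d^2$ equal to multiplication by $t$. Take exact sequences in $\mathcal{F}$ to be sequences $(X,d)\to(Y,d)\to(Z,d)$ where $X\to Y\to Z$ is split exact in $\mathcal{P}$. Then $\mathcal{F}$ is a Frobenius category with projective-injective objects the direct summands of $\left(X^2,\begin{bmatrix}0&t\\1&0\end{bmatrix}\right)$ for $X$ in $\mathcal{P}$.
   Context: An $R$-category is a category enriched over $R$-modules. Morphisms $(V,d)\to(W,d)$ in $\mathcal{F}$ are morphisms $f:V\to W$ in $\mathcal{P}$ with $fd=df$. $X^2=X\oplus X$. A Frobenius category is an exact category with enough projectives and enough injectives in which the projective and injective objects coincide. *)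

(* Defs.v *)
From HB Require Import structures.
From mathcomp Require Import all_boot all_order all_algebra.

Set Implicit Arguments.
Unset Strict Implicit.
Unset Printing Implicit Defensive.

Import GRing.Theory.
Local Open Scope ring_scope.

(* Rings. [A] may be noncommutative and may be the zero ring (the endomorphism
   ring of a zero object is), hence [pzRingType]. *)

Section Rings.
Variable A : pzRingType.
Implicit Types I J M : A -> Prop.

Definition left_ideal I : Prop :=
  [/\ I 0, forall x y, I x -> I y -> I (x + y) & forall a x, I x -> I (a * x)].

Definition maximal_left_ideal M : Prop :=
  [/\ left_ideal M, ~ M 1 &
      forall J, left_ideal J -> (forall x, M x -> J x) -> ~ J 1 ->
      forall x, J x -> M x].

(* Exactly one maximal left ideal; uniqueness is extensional. *)
Definition local_ring : Prop :=
  exists2 M, maximal_left_ideal M &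
    forall M', maximal_left_ideal M' -> forall x, M' x <-> M x.

Definition left_principal (a : A) : A -> Prop := fun x => exists b, x = b * a.

Definition commutative_local_ring : Prop :=
  commutative (@GRing.mul A) /\ local_ring.

End Rings.

(* A local principal ideal domain that is not a field. *)
Definition discrete_valuation_ring (R : idomainType) : Prop :=
  [/\ forall I : R -> Prop, left_ideal I ->
        exists a, forall x, I x <-> left_principal a x,
      local_ring R &
      exists2 x : R, x != 0 & x \isn't a GRing.unit].

Definition uniformizer (R : idomainType) (t : R) : Prop :=
  maximal_left_ideal (left_principal t).

(* Categories enriched over R-modules. [mcomp g f] is "g after f". *)

Record Rcategory (R : comNzRingType) := RCategory {
  Ob :> Type;
  Hom : Ob -> Ob -> lmodType R;
  idm : forall X, Hom X X;
  mcomp : forall X Y Z, Hom Y Z -> Hom X Y -> Hom X Z;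
  compA : forall X Y Z W (h : Hom Z W) (g : Hom Y Z) (f : Hom X Y),
    mcomp h (mcomp g f) = mcomp (mcomp h g) f;
  comp1m : forall X Y (f : Hom X Y), mcomp (idm Y) f = f;
  compm1 : forall X Y (f : Hom X Y), mcomp f (idm X) = f;
  compDl : forall X Y Z (g h : Hom Y Z) (f : Hom X Y),
    mcomp (g + h) f = mcomp g f + mcomp h f;
  compDr : forall X Y Z (g : Hom Y Z) (f h : Hom X Y),
    mcomp g (f + h) = mcomp g f + mcomp g h;
  compZl : forall X Y Z (a : R) (g : Hom Y Z) (f : Hom X Y),
    mcomp (a *: g) f = a *: mcomp g f;
  compZr : forall X Y Z (a : R) (g : Hom Y Z) (f : Hom X Y),
    mcomp g (a *: f) = a *: mcomp g f
}.

Arguments Hom {R C} X Y : rename.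
Arguments idm {R C} X : rename.
Arguments mcomp {R C X Y Z} g f : rename.

Notation "g \oo f" := (mcomp g f) (at level 40, left associativity).

(* [EndRing X] is a ring under composition; together with the module structure of
   [Hom X X] and [compZl], [compZr] this is its R-algebra structure. *)
Section EndomorphismRing.
Variables (R : comNzRingType) (C : Rcategory R) (X : C).

Definition EndRing : Type := Hom X X.

HB.instance Definition _ := GRing.Lmodule.on EndRing.
HB.instance Definition _ := GRing.Zmodule_isPzRing.Build EndRing
  (@compA _ C X X X X) (@comp1m _ C X X) (@compm1 _ C X X)
  (fun g h f => compDl g h f) (fun g f h => compDr g f h).

End EndomorphismRing.

Section CategoryNotions.
Variables (R : comNzRingType) (C : Rcategory R).
Implicit Types X Y Z W S : C.

Lemma comp0m X Y Z (f : Hom X Y) : (0 : Hom Y Z) \oo f = 0.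
Proof. by rewrite -(scale0r (0 : Hom Y Z)) compZl scale0r. Qed.

Lemma compm0 X Y Z (g : Hom Y Z) : g \oo (0 : Hom X Y) = 0.
Proof. by rewrite -(scale0r (0 : Hom X Y)) compZr scale0r. Qed.

Definition isomorphism X Y (f : Hom X Y) : Prop :=
  exists2 g : Hom Y X, g \oo f = idm X & f \oo g = idm Y.

(* Initial and terminal; existence of morphisms is automatic. *)
Definition zero_object Z : Prop :=
  forall X, (forall f g : Hom Z X, f = g) /\ (forall f g : Hom X Z, f = g).

(* The ways of presenting S as a direct sum of X and Y. *)
Record biproduct X Y S := Biproduct {
  in1 : Hom X S;
  in2 : Hom Y S;
  pr1 : Hom S X;
  pr2 : Hom S Y;
  pr1_in1 : pr1 \oo in1 = idm X;
  pr2_in2 : pr2 \oo in2 = idm Y;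
  pr2_in1 : pr2 \oo in1 = 0;
  pr1_in2 : pr1 \oo in2 = 0;
  biproduct_id : in1 \oo pr1 + in2 \oo pr2 = idm S
}.

(* The endomorphism of a direct sum S = X + X with matrix [a b; c d], acting on
   columns. *)
Definition mx2 X S (B : biproduct X X S) (a b c d : Hom X X) : Hom S S :=
  in1 B \oo a \oo pr1 B + in1 B \oo b \oo pr2 B +
  in2 B \oo c \oo pr1 B + in2 B \oo d \oo pr2 B.

Definition additive_category : Prop :=
  (exists Z, zero_object Z) /\
  (forall X Y, exists S, inhabited (biproduct X Y S)).

Definition direct_summand X S : Prop :=
  exists Y, inhabited (biproduct X Y S).

Definition indecomposable X : Prop :=
  ~ zero_object X /\
  forall Y Z, inhabited (biproduct Y Z X) -> zero_object Y \/ zero_object Z.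

Definition finite_direct_sum n (Y : 'I_n -> C) X : Prop :=
  exists (i : forall k, Hom (Y k) X) (p : forall k, Hom X (Y k)),
  [/\ forall k, p k \oo i k = idm (Y k),
      forall j k, j != k -> p j \oo i k = 0 &
      \sum_(k < n) i k \oo p k = idm X].

(* Used for additive categories only. *)
Definition Krull_Schmidt : Prop :=
  forall X, exists n (Y : 'I_n -> C),
    finite_direct_sum Y X /\ forall k, local_ring (EndRing (Y k)).

Definition is_kernel X Y Z (i : Hom X Y) (p : Hom Y Z) : Prop :=
  p \oo i = 0 /\
  forall W (f : Hom W Y), p \oo f = 0 -> exists! g : Hom W X, i \oo g = f.

Definition is_cokernel X Y Z (i : Hom X Y) (p : Hom Y Z) : Prop :=
  p \oo i = 0 /\
  forall W (f : Hom Y W), f \oo i = 0 -> exists! g : Hom Z W, g \oo p = f.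

(* X -> Y -> Z is split exact: Y is a direct sum of X and Z with i the
   inclusion of X and p the projection to Z. *)
Definition split_exact X Y Z (i : Hom X Y) (p : Hom Y Z) : Prop :=
  exists B : biproduct X Z Y, in1 B = i /\ pr2 B = p.

Definition pushout X Y X' Y' (i : Hom X Y) (f : Hom X X')
    (f' : Hom Y Y') (i' : Hom X' Y') : Prop :=
  f' \oo i = i' \oo f /\
  forall W (u : Hom Y W) (v : Hom X' W), u \oo i = v \oo f ->
    exists! w : Hom Y' W, w \oo f' = u /\ w \oo i' = v.

Definition pullback Y Z Y' Z' (p : Hom Y Z) (f : Hom Z' Z)
    (f' : Hom Y' Y) (p' : Hom Y' Z') : Prop :=
  p \oo f' = f \oo p' /\
  forall W (u : Hom W Y) (v : Hom W Z'), p \oo u = f \oo v ->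
    exists! w : Hom W Y', f' \oo w = u /\ p' \oo w = v.

(* Exact categories in the sense of Quillen, in Buehler's axiomatization.
   [E i p] says that X -i-> Y -p-> Z is one of the chosen exact sequences. *)
Section Exact.
Variable E : forall X Y Z, Hom X Y -> Hom Y Z -> Prop.

Definition admissible_mono X Y (i : Hom X Y) : Prop :=
  exists Z (p : Hom Y Z), E i p.

Definition admissible_epi Y Z (p : Hom Y Z) : Prop :=
  exists X (i : Hom X Y), E i p.

Record exact_category : Prop := ExactCategory {
  exact_additive : additive_category;
  exact_kernel_cokernel : forall X Y Z (i : Hom X Y) (p : Hom Y Z),
    E i p -> is_kernel i p /\ is_cokernel i p;
  exact_iso : forall X Y Z X' Y' Z' (i : Hom X Y) (p : Hom Y Z)
      (i' : Hom X' Y') (p' : Hom Y' Z')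
      (a : Hom X X') (b : Hom Y Y') (c : Hom Z Z'),
    isomorphism a -> isomorphism b -> isomorphism c ->
    b \oo i = i' \oo a -> c \oo p = p' \oo b -> E i p -> E i' p';
  exact_id_mono : forall X, admissible_mono (idm X);
  exact_id_epi : forall X, admissible_epi (idm X);
  exact_comp_mono : forall X Y Z (i : Hom X Y) (j : Hom Y Z),
    admissible_mono i -> admissible_mono j -> admissible_mono (j \oo i);
  exact_comp_epi : forall X Y Z (p : Hom X Y) (q : Hom Y Z),
    admissible_epi p -> admissible_epi q -> admissible_epi (q \oo p);
  exact_pushout : forall X Y X' (i : Hom X Y) (f : Hom X X'),
    admissible_mono i ->
    exists Y' (f' : Hom Y Y') (i' : Hom X' Y'),
      pushout i f f' i' /\ admissible_mono i';
  exact_pullback : forall Y Z Z' (p : Hom Y Z) (f : Hom Z' Z),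
    admissible_epi p ->
    exists Y' (f' : Hom Y' Y) (p' : Hom Y' Z'),
      pullback p f f' p' /\ admissible_epi p'
}.

Definition projective_object P : Prop :=
  forall Y Z (p : Hom Y Z), admissible_epi p ->
  forall f : Hom P Z, exists g : Hom P Y, p \oo g = f.

Definition injective_object I : Prop :=
  forall X Y (i : Hom X Y), admissible_mono i ->
  forall f : Hom X I, exists g : Hom Y I, g \oo i = f.

Definition enough_projectives : Prop :=
  forall X, exists P (p : Hom P X), projective_object P /\ admissible_epi p.

Definition enough_injectives : Prop :=
  forall X, exists I (i : Hom X I), injective_object I /\ admissible_mono i.

Definition Frobenius_category : Prop :=
  [/\ exact_category, enough_projectives, enough_injectives &
      forall X, projective_object X <-> injective_object X].

End Exact.
End CategoryNotions.

(* The category of pairs (V, d) with d^2 = t. *)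
Section SquareRoots.
Variables (R : comNzRingType) (P : Rcategory R) (t : R).

Record Fob := FOb {
  Fund : P;
  Fd : Hom Fund Fund;
  Fd_sq : Fd \oo Fd = t *: idm Fund
}.

Definition Fcommutes (V W : Fob) : pred (Hom (Fund V) (Fund W)) :=
  fun f => f \oo Fd V == Fd W \oo f.

Fact Fcommutes_submod (V W : Fob) : subsemimod_closed (@Fcommutes V W).
Proof.
split; first split.
- by rewrite unfold_in /Fcommutes comp0m compm0.
- move=> f g /eqP cf /eqP cg; rewrite unfold_in /Fcommutes.
  by rewrite compDl compDr cf cg.
- by move=> a f /eqP cf; rewrite unfold_in /Fcommutes compZl compZr cf.
Qed.

HB.instance Definition _ (V W : Fob) :=
  GRing.isSubmodClosed.Build R (Hom (Fund V) (Fund W)) (@Fcommutes V W)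
    (Fcommutes_submod V W).

Record Fhom (V W : Fob) := FHom {
  Fval : Hom (Fund V) (Fund W);
  Fval_comm : Fcommutes Fval
}.

HB.instance Definition _ V W := [isSub for @Fval V W].
HB.instance Definition _ V W := [Choice of Fhom V W by <:].
HB.instance Definition _ V W := [SubChoice_isSubLmodule of Fhom V W by <:].

Definition Fid (V : Fob) : Fhom V V.
Proof. by exists (idm (Fund V)); rewrite /Fcommutes comp1m compm1. Defined.

Definition Fcomp (U V W : Fob) (g : Fhom V W) (f : Fhom U V) : Fhom U W.
Proof.
exists (Fval g \oo Fval f); rewrite /Fcommutes.
by rewrite -compA (eqP (Fval_comm f)) !compA (eqP (Fval_comm g)).
Defined.

Definition Fcat : Rcategory R.
Proof.
refine (@RCategory R Fob (fun V W => Fhom V W) Fid Fcomp _ _ _ _ _ _ _).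
- by move=> *; apply: val_inj; apply: compA.
- by move=> *; apply: val_inj; apply: comp1m.
- by move=> *; apply: val_inj; apply: compm1.
- by move=> *; apply: val_inj; apply: compDl.
- by move=> *; apply: val_inj; apply: compDr.
- by move=> *; apply: val_inj; apply: compZl.
- by move=> *; apply: val_inj; apply: compZr.
Defined.

Definition Fexact (X Y Z : Fcat) (i : Hom X Y) (p : Hom Y Z) : Prop :=
  split_exact (Fval i) (Fval p).

Definition double_d (X S : P) (B : biproduct X X S) : Hom S S :=
  mx2 B 0 (t *: idm X) (idm X) 0.

Fact double_d_sq (X S : P) (B : biproduct X X S) :
  double_d B \oo double_d B = t *: idm S.
Proof.
have -> : double_d B = t *: (in1 B \oo pr2 B) + in2 B \oo pr1 B.
  by rewrite /double_d /mx2 !compm0 !comp0m compZr compZl !compm1 add0r addr0.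
have E (U V W Q T : P) (a : Hom W Q) (b : Hom V W) (c : Hom U V)
    (d : Hom T U) : a \oo b \oo (c \oo d) = a \oo (b \oo c) \oo d.
  by rewrite !compA.
rewrite !(compDl, compDr, compZl, compZr) !E pr1_in1 pr2_in2 pr2_in1 pr1_in2.
rewrite !compm0 !comp0m !compm1 !scaler0 add0r addr0 -scalerDr.
by rewrite biproduct_id.
Qed.

(* (X^2, [0 t; 1 0]), for a given direct sum S = X^2. *)
Definition Fdouble (X S : P) (B : biproduct X X S) : Fcat := FOb (double_d_sq B).

End SquareRoots.

(* Main.v *)
Require Import Defs.
From mathcomp Require Import all_boot all_order all_algebra.

(** The forgetful functor from pairs (V, d) to P creates everything the
    exact structure needs. A complement A of V in W, for a morphism
    V -> W of pairs that is a split monomorphism in P, carries a unique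
    square root of t making W -> A a morphism of pairs: the (2,2) entry of
    the upper triangular matrix of the endomorphism of W. So admissibility
    of a monomorphism (or, dually, of an epimorphism) can be tested in P;
    these are [admissible_monoP] and [admissible_epiP]. Likewise a pushout
    or pullback computed in P acquires its square root of t from the
    universal property ([lift_pushout], [lift_pullback]). The axioms of an
    exact category then follow from those of the split exact structure of P.

    The object D(X) = (X^2, [0 t; 1 0]) is the value at X of both a left and
    a right adjoint of the forgetful functor: a morphism D(X) -> (V, d) has
    the form (a, d a) for a unique a : X -> V, and a morphism (V, d) -> D(X)
    is the column (b d; b) for a unique b : V -> X. Since every exact
    sequence of pairs splits after forgetting, D(X) is projective and
    injective ([Fdouble_projective], [Fdouble_injective]). The counit
    D(V) -> (V, d) and the unit (V, d) -> D(V) are respectively an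
    admissible epimorphism and an admissible monomorphism, with kernel and
    cokernel (V, -d). Hence there are enough projectives and injectives, and
    an object that is projective or injective is a retract of some D(V),
    hence both. A retract of D(V) through an admissible epimorphism
    D(V) -> A is moreover a direct summand: the kernel of that epimorphism
    is a complement ([kernel_section_summand]). *)

Set Implicit Arguments.
Unset Strict Implicit.
Unset Printing Implicit Defensive.

Import Defs.
Import GRing.Theory.
Local Open Scope ring_scope.

(** * Split sequences in an R-category *)

Section Splitting.
Variables (R : comNzRingType) (C : Rcategory R).
Implicit Types X Y Z W S : C.

Lemma compNm X Y Z (g : Hom Y Z) (f : Hom X Y) : (- g) \oo f = - (g \oo f).
Proof. by rewrite -scaleN1r compZl scaleN1r. Qed.

Lemma compmN X Y Z (g : Hom Y Z) (f : Hom X Y) : g \oo (- f) = - (g \oo f).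
Proof. by rewrite -scaleN1r compZr scaleN1r. Qed.

Section BiproductCalculus.
Variables (X Y S : C) (B : biproduct X Y S).

(* The biproduct equations in the form in which they rewrite inside a
   composite bracketed to the left. *)
Lemma comp_pr1_in1 W (f : Hom X W) : f \oo pr1 B \oo in1 B = f.
Proof. by rewrite -compA pr1_in1 compm1. Qed.

Lemma comp_pr2_in2 W (f : Hom Y W) : f \oo pr2 B \oo in2 B = f.
Proof. by rewrite -compA pr2_in2 compm1. Qed.

Lemma comp_pr2_in1 W (f : Hom Y W) : f \oo pr2 B \oo in1 B = 0.
Proof. by rewrite -compA pr2_in1 compm0. Qed.

Lemma comp_pr1_in2 W (f : Hom X W) : f \oo pr1 B \oo in2 B = 0.
Proof. by rewrite -compA pr1_in2 compm0. Qed.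

Definition biE := (pr1_in1, pr2_in2, pr2_in1, pr1_in2,
  comp_pr1_in1, comp_pr2_in2, comp_pr2_in1, comp_pr1_in2).

Lemma split_source W (f : Hom S W) :
  f = f \oo in1 B \oo pr1 B + f \oo in2 B \oo pr2 B.
Proof. by rewrite -!compA -compDr biproduct_id compm1. Qed.

Lemma split_target W (f : Hom W S) :
  f = in1 B \oo pr1 B \oo f + in2 B \oo pr2 B \oo f.
Proof. by rewrite -compDl biproduct_id comp1m. Qed.

End BiproductCalculus.

(* Normalization of composites: distribute, bracket to the left, drop
   identities and zeros. *)
Definition compE := (compDl, compDr, compA, compNm, compmN, compZl, compZr,
  comp1m, compm1, comp0m, compm0, add0r, addr0, oppr0, scaler0).

Definition swap_biproduct X Y S (B : biproduct X Y S) : biproduct Y X S.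
Proof.
by exists (in2 B) (in1 B) (pr2 B) (pr1 B); rewrite ?biE // addrC biproduct_id.
Defined.

(** Reassociation of (X + A) + B as X + (A + B). Read off the inclusion of X,
    it shows that split monomorphisms compose; read off the projection to X,
    that split epimorphisms do. *)
Lemma biproductA X A Y B Z T (BY : biproduct X A Y) (BZ : biproduct Y B Z)
    (BT : biproduct A B T) :
  exists BX : biproduct X T Z,
    in1 BX = in1 BZ \oo in1 BY /\ pr1 BX = pr1 BY \oo pr1 BZ.
Proof.
unshelve eexists.
  exists (in1 BZ \oo in1 BY)
         (in1 BZ \oo in2 BY \oo pr1 BT + in2 BZ \oo pr2 BT)
         (pr1 BY \oo pr1 BZ)
         (in1 BT \oo pr2 BY \oo pr1 BZ + in2 BT \oo pr2 BZ).
  - by rewrite !compE !biE.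
  - by rewrite !(compE, biE) biproduct_id.
  - by rewrite !(compE, biE).
  - by rewrite !(compE, biE).
  - rewrite !(compE, biE) addrA -(biproduct_id BZ); congr (_ + _).
    by rewrite -!compA -!compDr !compA -compDl biproduct_id comp1m.
by [].
Qed.

Lemma zero_biproduct X Z : zero_object Z ->
  exists B : biproduct X Z X, in1 B = idm X /\ pr1 B = idm X.
Proof.
move=> Z0; unshelve eexists.
  exists (idm X) 0 (idm X) 0; rewrite ?compE //.
  by case: (Z0 Z) => e _; apply: e.
by [].
Qed.

Lemma split_exact_kernel X Y Z (i : Hom X Y) (p : Hom Y Z) :
  split_exact i p -> is_kernel i p.
Proof.
case=> B [<- <-]; split=> [|W f pf0]; first by rewrite biE.
exists (pr1 B \oo f); split=> [|g <-]; last by rewrite !(compE, biE).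
by rewrite [RHS](split_target B) -[in2 B \oo _ \oo f]compA pf0 !compE.
Qed.

Lemma split_exact_cokernel X Y Z (i : Hom X Y) (p : Hom Y Z) :
  split_exact i p -> is_cokernel i p.
Proof.
case=> B [<- <-]; split=> [|W f fi0]; first by rewrite biE.
exists (f \oo in2 B); split=> [|g <-]; last by rewrite !(compE, biE).
by rewrite [RHS](split_source B) fi0 !compE.
Qed.

Lemma split_exact_iso X Y Z X' Y' Z' (i : Hom X Y) (p : Hom Y Z)
    (i' : Hom X' Y') (p' : Hom Y' Z')
    (a : Hom X X') (b : Hom Y Y') (c : Hom Z Z') :
  isomorphism a -> isomorphism b -> isomorphism c ->
  b \oo i = i' \oo a -> c \oo p = p' \oo b ->
  split_exact i p -> split_exact i' p'.
Proof.
case=> a' a'a aa' [b' b'b bb'] [c' c'c cc'] bi cp [B [iE pE]].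
have b'bK W (f : Hom Y W) : f \oo b' \oo b = f.
  by rewrite -compA b'b compm1.
have a'aK W (f : Hom X W) : f \oo a' \oo a = f.
  by rewrite -compA a'a compm1.
have c'cK W (f : Hom Z W) : f \oo c' \oo c = f.
  by rewrite -compA c'c compm1.
unshelve eexists.
  exists (b \oo in1 B \oo a') (b \oo in2 B \oo c')
         (a \oo pr1 B \oo b') (c \oo pr2 B \oo b');
    rewrite !(compE, b'bK, a'aK, c'cK, biE) //.
  by rewrite -compDl -!compA -compDr biproduct_id compm1.
split=> /=; first by rewrite iE bi -compA aa' compm1.
by rewrite pE cp -compA bb' compm1.
Qed.

(** A section of p makes the kernel of p a complement, because the idempotent
    id - s p is killed by p and so factors through the kernel. *)
Lemma kernel_section_summand X Y Z (i : Hom X Y) (p : Hom Y Z) (s : Hom Z Y) :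
  is_kernel i p -> p \oo s = idm Z -> direct_summand Z Y.
Proof.
case=> pi0 ker ps1; exists X.
have i_mono W (f g : Hom W X) : i \oo f = i \oo g -> f = g.
  move=> ifg; have [|h [_ h_uniq]] := ker W (i \oo g).
    by rewrite compA pi0 comp0m.
  by rewrite -(h_uniq f) // -(h_uniq g).
have [|r [ir _]] := ker Y (idm Y - s \oo p).
  by rewrite !compE ps1 comp1m subrr.
split; exists s i p r => //.
- by apply: i_mono; rewrite compA ir !compE -compA pi0 !compE.
- by apply: i_mono; rewrite compA ir !compE -compA ps1 !compE subrr.
- by rewrite ir addrC subrK.
Qed.

(** Pushing out a direct sum X + Z along X -> X' replaces X by X'. *)
Lemma split_pushout X Z Y X' S (B : biproduct X Z Y) (f : Hom X X')
    (B' : biproduct X' Z S) :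
  pushout (in1 B) f (in1 B' \oo f \oo pr1 B + in2 B' \oo pr2 B) (in1 B').
Proof.
split=> [|W u v uv]; first by rewrite !(compE, biE).
exists (v \oo pr1 B' + u \oo in2 B \oo pr2 B'); split.
  by rewrite !(compE, biE) -uv -split_source.
move=> w [wu wv]; rewrite [RHS](split_source B') wv -wu.
by rewrite !(compE, biE).
Qed.

Lemma split_pullback K Z Y Z' S (B : biproduct K Z Y) (f : Hom Z' Z)
    (B' : biproduct K Z' S) :
  pullback (pr2 B) f (in1 B \oo pr1 B' + in2 B \oo f \oo pr2 B') (pr2 B').
Proof.
split=> [|W u v uv]; first by rewrite !(compE, biE).
exists (in1 B' \oo pr1 B \oo u + in2 B' \oo v); split.
  rewrite !(compE, biE); split=> //.
  by rewrite -[in2 B \oo f \oo v]compA -uv compA -split_target.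
move=> w [wu wv]; rewrite [RHS](split_target B').
by rewrite -[in2 B' \oo _ \oo w]compA wv -wu !(compE, biE).
Qed.

Lemma pushout_ext X Y X' S (i : Hom X Y) (f : Hom X X') (f' : Hom Y S)
    (i' : Hom X' S) W (w w' : Hom S W) :
  pushout i f f' i' -> w \oo f' = w' \oo f' -> w \oo i' = w' \oo i' -> w = w'.
Proof.
case=> sq univ wf wi; have [|h [_ h_uniq]] := univ W (w' \oo f') (w' \oo i').
  by rewrite -!compA sq.
by rewrite -(h_uniq w) // -(h_uniq w').
Qed.

Lemma pullback_ext Y Z Z' S (p : Hom Y Z) (f : Hom Z' Z) (f' : Hom S Y)
    (p' : Hom S Z') W (w w' : Hom W S) :
  pullback p f f' p' -> f' \oo w = f' \oo w' -> p' \oo w = p' \oo w' -> w = w'.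
Proof.
case=> sq univ wf wp; have [|h [_ h_uniq]] := univ W (f' \oo w') (p' \oo w').
  by rewrite !compA sq.
by rewrite -(h_uniq w) // -(h_uniq w').
Qed.

Definition retract X S : Prop :=
  exists (s : Hom X S) (p : Hom S X), p \oo s = idm X.

Lemma summand_retract X S : direct_summand X S -> retract X S.
Proof. by case=> Y [B]; exists (in1 B), (pr1 B); rewrite biE. Qed.

Section RetractLifting.
Variable E : forall X Y Z, Hom X Y -> Hom Y Z -> Prop.

Lemma retract_projective X S :
  retract X S -> projective_object E S -> projective_object E X.
Proof.
case=> s [q qs1] projS Y Z p Ep f; have [g pg] := projS _ _ _ Ep (f \oo q).
by exists (g \oo s); rewrite compA pg -compA qs1 compm1.
Qed.

Lemma retract_injective X S :
  retract X S -> injective_object E S -> injective_object E X.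
Proof.
case=> s [q qs1] injS Y Z i Ei f; have [g gi] := injS _ _ _ Ei (s \oo f).
by exists (q \oo g); rewrite -compA gi compA qs1 comp1m.
Qed.

End RetractLifting.

End Splitting.

(** * Lifting along the forgetful functor *)

Section Lifting.
Variables (R : comNzRingType) (P : Rcategory R) (t : R).
Local Notation F := (Fcat P t).
Local Notation E := (@Fexact R P t).
Implicit Types V W X Y Z : F.

Lemma Fval_commE V W (f : Hom V W) : Fval f \oo Fd V = Fd W \oo Fval f.
Proof. exact/eqP/Fval_comm. Qed.

Lemma comp_Fd_sq V U (f : Hom (Fund V) U) : f \oo Fd V \oo Fd V = t *: f.
Proof. by rewrite -compA Fd_sq !compE. Qed.

Lemma Fval_isomorphism V W (f : Hom V W) :
  isomorphism f -> isomorphism (Fval f).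
Proof.
by case=> g gf fg; exists (Fval g); [move/(congr1 val): gf | move/(congr1 val): fg].
Qed.

(** The factorization found in P is a morphism of pairs because it becomes
    one after composition with the monomorphism i, which can be cancelled. *)
Lemma lift_kernel X Y Z (i : Hom X Y) (p : Hom Y Z) :
  is_kernel (Fval i) (Fval p) -> is_kernel i p.
Proof.
case=> pi0 ker; split=> [|W f pf0]; first exact: val_inj.
have i_mono U (g h : Hom U (Fund X)) :
    Fval i \oo g = Fval i \oo h -> g = h.
  move=> igh; have [|k [_ k_uniq]] := ker U (Fval i \oo h).
    by rewrite compA pi0 comp0m.
  by rewrite -(k_uniq g) // -(k_uniq h).
have [g [ig _]] := ker _ (Fval f) (congr1 val pf0).
have cg : Fcommutes (V := W) (W := X) g.
  apply/eqP/i_mono; rewrite !compA ig (Fval_commE i) -compA ig.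
  exact: Fval_commE.
exists (FHom cg : Hom W X); split=> [|h ih]; first exact: val_inj.
by apply: val_inj; apply: i_mono; rewrite /= ig -ih.
Qed.

Lemma lift_cokernel X Y Z (i : Hom X Y) (p : Hom Y Z) :
  is_cokernel (Fval i) (Fval p) -> is_cokernel i p.
Proof.
case=> pi0 coker; split=> [|W f fi0]; first exact: val_inj.
have p_epi U (g h : Hom (Fund Z) U) :
    g \oo Fval p = h \oo Fval p -> g = h.
  move=> ghp; have [|k [_ k_uniq]] := coker U (h \oo Fval p).
    by rewrite -compA pi0 compm0.
  by rewrite -(k_uniq g) // -(k_uniq h).
have [g [gp _]] := coker _ (Fval f) (congr1 val fi0).
have cg : Fcommutes (V := Z) (W := W) g.
  apply/eqP/p_epi; rewrite -!compA gp -(Fval_commE p) compA gp.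
  exact: Fval_commE.
exists (FHom cg : Hom Z W); split=> [|h hp]; first exact: val_inj.
by apply: val_inj; apply: p_epi; rewrite /= gp -hp.
Qed.

(** The endomorphism of W preserves the image of V, so it is upper
    triangular in a decomposition W = V + A, and its entry on A squares to
    t because diagonal entries of upper triangular matrices multiply. *)
Lemma admissible_monoP V W (f : Hom V W) :
  admissible_mono E f <->
  exists A (B : biproduct (Fund V) A (Fund W)), in1 B = Fval f.
Proof.
split=> [[Z [p [B [iB _]]]] | [A [B iB]]]; first by exists (Fund Z), B.
have triangular : pr2 B \oo Fd W = pr2 B \oo Fd W \oo in2 B \oo pr2 B.
  rewrite {1}[pr2 B \oo Fd W](split_source B).
  by rewrite -[_ \oo in1 B]compA iB -(Fval_commE f) -iB !(compE, biE).
have sq : (pr2 B \oo Fd W \oo in2 B) \oo (pr2 B \oo Fd W \oo in2 B)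
          = t *: idm A.
  by rewrite !compA -triangular comp_Fd_sq !(compE, biE).
have c : Fcommutes (V := W) (W := FOb sq) (pr2 B) by apply/eqP.
by exists (FOb sq : F), (FHom c); exists B.
Qed.

Lemma admissible_epiP V W (f : Hom V W) :
  admissible_epi E f <->
  exists A (B : biproduct A (Fund W) (Fund V)), pr2 B = Fval f.
Proof.
split=> [[Z [p [B [_ pB]]]] | [A [B pB]]]; first by exists (Fund Z), B.
have triangular : Fd V \oo in1 B = in1 B \oo (pr1 B \oo Fd V \oo in1 B).
  rewrite {1}[Fd V \oo in1 B](split_target B).
  rewrite -[in2 B \oo _ \oo _]compA [pr2 B \oo (_ \oo _)]compA pB.
  by rewrite (Fval_commE f) -pB !(compE, biE).
have sq : (pr1 B \oo Fd V \oo in1 B) \oo (pr1 B \oo Fd V \oo in1 B)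
          = t *: idm A.
  rewrite -[LHS]compA -triangular -compA [Fd V \oo (_ \oo _)]compA Fd_sq.
  by rewrite !(compE, biE).
have c : Fcommutes (V := FOb sq) (W := V) (in1 B) by apply/eqP.
by exists (FOb sq : F), (FHom c); exists B.
Qed.

(** The square root of t on the pushout is induced by those on Y and X';
    that it squares to t, and that induced morphisms commute with it, is the
    uniqueness part of the universal property. *)
Lemma lift_pushout X Y X' (i : Hom X Y) (f : Hom X X') S
    (f' : Hom (Fund Y) S) (i' : Hom (Fund X') S) :
  pushout (Fval i) (Fval f) f' i' ->
  exists (d : Hom S S) (d_sq : d \oo d = t *: idm S)
    (cf : Fcommutes (V := Y) (W := FOb d_sq) f')
    (ci : Fcommutes (V := X') (W := FOb d_sq) i'),
    pushout (C := F) (Y' := FOb d_sq) i f (FHom cf) (FHom ci).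
Proof.
move=> po; have ext := pushout_ext po; case: po => sq univ.
have [|d [[df di] _]] := univ S (f' \oo Fd Y) (i' \oo Fd X').
  by rewrite -!compA -(Fval_commE f) -(Fval_commE i) !compA sq.
have d_sq : d \oo d = t *: idm S.
  apply: ext; rewrite -compA ?df ?di compA ?df ?di -compA Fd_sq;
    by rewrite !compE.
have cf : Fcommutes (V := Y) (W := FOb d_sq) f' by apply/eqP; rewrite df.
have ci : Fcommutes (V := X') (W := FOb d_sq) i' by apply/eqP; rewrite di.
exists d, d_sq, cf, ci; split=> [|W u v uv]; first exact: val_inj.
have [w [[wf wi] _]] := univ _ (Fval u) (Fval v) (congr1 val uv).
have cw : Fcommutes (V := FOb d_sq) (W := W) w.
  apply/eqP/ext; rewrite -[LHS]compA -[RHS]compA ?df ?di [LHS]compA ?wf ?wi;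
    exact: Fval_commE.
exists (FHom cw : Hom (FOb d_sq : F) W); split=> [|h [hf hi]].
  by split; apply: val_inj.
by apply: val_inj; apply: ext; rewrite /= ?wf ?wi -?hf -?hi.
Qed.

Lemma lift_pullback Y Z Z' (p : Hom Y Z) (f : Hom Z' Z) S
    (f' : Hom S (Fund Y)) (p' : Hom S (Fund Z')) :
  pullback (Fval p) (Fval f) f' p' ->
  exists (d : Hom S S) (d_sq : d \oo d = t *: idm S)
    (cf : Fcommutes (V := FOb d_sq) (W := Y) f')
    (cp : Fcommutes (V := FOb d_sq) (W := Z') p'),
    pullback (C := F) (Y' := FOb d_sq) p f (FHom cf) (FHom cp).
Proof.
move=> pb; have ext := pullback_ext pb; case: pb => sq univ.
have [|d [[df dp] _]] := univ S (Fd Y \oo f') (Fd Z' \oo p').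
  by rewrite !compA (Fval_commE f) (Fval_commE p) -!compA sq.
have d_sq : d \oo d = t *: idm S.
  apply: ext; rewrite compA ?df ?dp -compA ?df ?dp compA Fd_sq;
    by rewrite !compE.
have cf : Fcommutes (V := FOb d_sq) (W := Y) f' by apply/eqP; rewrite -df.
have cp : Fcommutes (V := FOb d_sq) (W := Z') p' by apply/eqP; rewrite -dp.
exists d, d_sq, cf, cp; split=> [|W u v uv]; first exact: val_inj.
have [w [[wf wp] _]] := univ _ (Fval u) (Fval v) (congr1 val uv).
have cw : Fcommutes (V := W) (W := FOb d_sq) w.
  apply/eqP/ext; rewrite [LHS]compA [RHS]compA ?df ?dp -[RHS]compA ?wf ?wp;
    exact: Fval_commE.
exists (FHom cw : Hom W (FOb d_sq : F)); split=> [|h [hf hp]].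
  by split; apply: val_inj.
by apply: val_inj; apply: ext; rewrite /= ?wf ?wp -?hf -?hp.
Qed.

Lemma Fcat_additive : additive_category P -> additive_category F.
Proof.
case=> [[Z Z0] sums]; split.
  have sq0 : (0 : Hom Z Z) \oo 0 = t *: idm Z by case: (Z0 Z) => e _; apply: e.
  exists (FOb sq0 : F) => V; case: (Z0 (Fund V)) => ZV VZ.
  by split=> f g; apply: val_inj; [apply: ZV | apply: VZ].
move=> X Y; have [S [B]] := sums (Fund X) (Fund Y).
pose d := in1 B \oo Fd X \oo pr1 B + in2 B \oo Fd Y \oo pr2 B.
have d_sq : d \oo d = t *: idm S.
  rewrite /d !(compE, biE) !comp_Fd_sq.
  by rewrite !compE -scalerDr biproduct_id.
have ci1 : Fcommutes (V := X) (W := FOb d_sq) (in1 B).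
  by apply/eqP; rewrite /= /d !(compE, biE).
have ci2 : Fcommutes (V := Y) (W := FOb d_sq) (in2 B).
  by apply/eqP; rewrite /= /d !(compE, biE).
have cp1 : Fcommutes (V := FOb d_sq) (W := X) (pr1 B).
  by apply/eqP; rewrite /= /d !(compE, biE).
have cp2 : Fcommutes (V := FOb d_sq) (W := Y) (pr2 B).
  by apply/eqP; rewrite /= /d !(compE, biE).
exists (FOb d_sq : F); split.
by exists (FHom ci1) (FHom ci2) (FHom cp1) (FHom cp2); apply: val_inj;
  rewrite /= ?biE ?biproduct_id.
Qed.

Lemma Fcat_exact : additive_category P -> exact_category E.
Proof.
move=> addP; have [[O O0] sums] := addP; split.
- exact: Fcat_additive.
- move=> X Y Z i p Eip; split; first exact/lift_kernel/split_exact_kernel.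
  exact/lift_cokernel/split_exact_cokernel.
- move=> X Y Z X' Y' Z' i p i' p' a b c /Fval_isomorphism isoa
    /Fval_isomorphism isob /Fval_isomorphism isoc /(congr1 val) bi
    /(congr1 val) cp.
  exact: split_exact_iso isoa isob isoc bi cp.
- move=> X; apply/admissible_monoP; exists O.
  by have [B [iE _]] := zero_biproduct (Fund X) O0; exists B.
- move=> X; apply/admissible_epiP; exists O.
  have [B [_ prE]] := zero_biproduct (Fund X) O0; exists (swap_biproduct B).
  exact: prE.
- move=> X Y Z i j /admissible_monoP[A [BY iE]] /admissible_monoP[B [BZ jE]].
  have [T [BT]] := sums A B; have [BX [inE _]] := biproductA BY BZ BT.
  by apply/admissible_monoP; exists T, BX; rewrite inE iE jE.
- move=> X Y Z p q /admissible_epiP[A [BX pE]] /admissible_epiP[B [BY qE]].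
  have [T [BT]] := sums B A.
  have [BZ [_ prE]] := biproductA (swap_biproduct BY) (swap_biproduct BX) BT.
  apply/admissible_epiP; exists T, (swap_biproduct BZ).
  by rewrite /= prE /= pE qE.
- move=> X Y X' i f /admissible_monoP[Z [B iE]].
  have [S [B']] := sums (Fund X') Z; have := split_pushout B (Fval f) B'.
  rewrite iE => /lift_pushout[d [d_sq [cf [ci po]]]].
  exists (FOb d_sq : F), (FHom cf), (FHom ci); split=> //.
  by apply/admissible_monoP; exists Z, B'.
- move=> Y Z Z' p f /admissible_epiP[K [B pE]].
  have [S [B']] := sums K (Fund Z'); have := split_pullback B (Fval f) B'.
  rewrite pE => /lift_pullback[d [d_sq [cf [cp pb]]]].
  exists (FOb d_sq : F), (FHom cf), (FHom cp); split=> //.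
  by apply/admissible_epiP; exists K, B'.
Qed.

(** * The objects (X^2, [0 t; 1 0]) *)

Section Double.
Variables (X S : P) (B : biproduct X X S).

Lemma double_dE : double_d t B = t *: (in1 B \oo pr2 B) + in2 B \oo pr1 B.
Proof. by rewrite /double_d /mx2 !compE. Qed.

(** A lift (a, d a) of f is determined by a lift a of the first column of f,
    which exists since p splits in P. *)
Lemma Fdouble_projective : projective_object E (Fdouble t B).
Proof.
move=> Y Z p /admissible_epiP[A [B' pE]] f.
have [a pa] : exists a, Fval p \oo a = Fval f \oo in1 B.
  by exists (in2 B' \oo Fval f \oo in1 B); rewrite -pE !(compE, biE).
have cg : Fcommutes (V := Fdouble t B) (W := Y)
    (a \oo pr1 B + Fd Y \oo a \oo pr2 B).
  by apply/eqP; rewrite /= double_dE !(compE, biE) Fd_sq !compE addrC.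
exists (FHom cg : Hom (Fdouble t B) Y); apply: val_inj => /=.
rewrite !compDr !compA (Fval_commE p) -[_ \oo Fval p \oo a]compA pa.
rewrite [RHS](split_source B) !compA -(Fval_commE f) /=.
by rewrite double_dE !(compE, biE).
Qed.

(** Dually, an extension (b d; b) of f is determined by an extension b of the
    second row of f. *)
Lemma Fdouble_injective : injective_object E (Fdouble t B).
Proof.
move=> V W i /admissible_monoP[A [B' iE]] f.
have [b bi] : exists b, b \oo Fval i = pr2 B \oo Fval f.
  by exists (pr2 B \oo Fval f \oo pr1 B'); rewrite -iE !(compE, biE).
have cg : Fcommutes (V := W) (W := Fdouble t B)
    (in1 B \oo b \oo Fd W + in2 B \oo b).
  by apply/eqP; rewrite /= double_dE !(compE, biE) comp_Fd_sq addrC.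
exists (FHom cg : Hom W (Fdouble t B)); apply: val_inj => /=.
rewrite !compDl -!compA -(Fval_commE i) [b \oo (_ \oo _)]compA bi.
rewrite [RHS](split_target B) -!compA (Fval_commE f) /=.
by rewrite double_dE !(compE, biE).
Qed.

End Double.

Section Resolution.
Variables (V : F) (S : P) (B : biproduct (Fund V) (Fund V) S).

(** The counit (1, d) : D(V) -> V of the left adjoint; its kernel is
    (-d; 1), from (V, -d). *)
Lemma double_cover : exists p : Hom (Fdouble t B) V, admissible_epi E p.
Proof.
have cp : Fcommutes (V := Fdouble t B) (W := V) (pr1 B + Fd V \oo pr2 B).
  by apply/eqP; rewrite /= double_dE !(compE, biE) Fd_sq !compE addrC.
exists (FHom cp : Hom (Fdouble t B) V); apply/admissible_epiP.
exists (Fund V); unshelve eexists.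
  exists (in2 B - in1 B \oo Fd V) (in1 B) (pr2 B) (pr1 B + Fd V \oo pr2 B);
    rewrite !(compE, biE) ?subrr ?subr0 //.
    by rewrite addrC subrr.
  by rewrite [in1 B \oo pr1 B + _]addrC addrA subrK addrC biproduct_id.
by [].
Qed.

(** The unit (d; 1) : V -> D(V) of the right adjoint; its cokernel is
    (1, -d), onto (V, -d). *)
Lemma double_hull : exists i : Hom V (Fdouble t B), admissible_mono E i.
Proof.
have ci : Fcommutes (V := V) (W := Fdouble t B) (in1 B \oo Fd V + in2 B).
  by apply/eqP; rewrite /= double_dE !(compE, biE) comp_Fd_sq addrC.
exists (FHom ci : Hom V (Fdouble t B)); apply/admissible_monoP.
exists (Fund V); unshelve eexists.
  exists (in1 B \oo Fd V + in2 B) (in1 B) (pr2 B) (pr1 B - Fd V \oo pr2 B);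
    rewrite !(compE, biE) ?subrr ?subr0 //.
  by rewrite addrC addrA subrK biproduct_id.
by [].
Qed.

End Resolution.

End Lifting.

(** * The Frobenius structure *)

Theorem proposition3p4p1 (R : idomainType) (t : R) (P : Rcategory R)
  (hR : discrete_valuation_ring R) (ht : uniformizer t)
  (hadd : additive_category P) (hKS : Krull_Schmidt P)
  (hEnd : forall X : P, indecomposable X -> commutative_local_ring (EndRing X)) :
  Frobenius_category (@Fexact R P t) /\
  forall A : Fcat P t,
    (projective_object (@Fexact R P t) A /\ injective_object (@Fexact R P t) A) <->
    exists (X X2 : P) (B : biproduct X X X2), direct_summand A (Fdouble t B).
Proof.
have [_ sums] := hadd.
have proj_summand A : projective_object (@Fexact R P t) A ->
    exists X X2 (B : biproduct X X X2), direct_summand A (Fdouble t B).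
  move=> projA; have [S [B]] := sums (Fund A) (Fund A).
  have [p Ep] := double_cover B; have [s ps1] := projA _ _ _ Ep (idm A).
  have [K [k Ekp]] := Ep.
  exists (Fund A), S, B; apply: kernel_section_summand ps1.
  exact: lift_kernel (split_exact_kernel Ekp).
have inj_retract A : injective_object (@Fexact R P t) A ->
    exists X X2 (B : biproduct X X X2), retract A (Fdouble t B).
  move=> injA; have [S [B]] := sums (Fund A) (Fund A).
  have [i Ei] := double_hull B; have [r ri1] := injA _ _ _ Ei (idm A).
  by exists (Fund A), S, B, i, r.
split.
  split; first exact: Fcat_exact.
  - move=> A; have [S [B]] := sums (Fund A) (Fund A).
    have [p Ep] := double_cover B.
    by exists (Fdouble t B), p; split=> //; apply: Fdouble_projective.
  - move=> A; have [S [B]] := sums (Fund A) (Fund A).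
    have [i Ei] := double_hull B.
    by exists (Fdouble t B), i; split=> //; apply: Fdouble_injective.
  - move=> A; split.
      case/proj_summand=> X [S [B /summand_retract]] /retract_injective.
      by apply; apply: Fdouble_injective.
    case/inj_retract=> X [S [B]] /retract_projective.
    by apply; apply: Fdouble_projective.
move=> A; split=> [[projA _]|]; first exact: proj_summand.
case=> X [S [B /summand_retract rA]]; split.
  by apply: retract_projective rA _; apply: Fdouble_projective.
by apply: retract_injective rA _; apply: Fdouble_injective.
Qed.
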